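(* For every multilinear tableau $T$, the number of set partitions $\mathcal{A}$ of $\mathrm{supp}(T)$ with $\mathcal{T}(\mathcal{A})=T$ equals $c(T)$.
   Context: A multilinear tableau of shape $\lambda=(\lambda_1,\dots,\lambda_m)$ is an array $T=(T_{ij})_{1\le i\le m,1\le j\le\lambda_i}$ of distinct positive integers whose rows increase left to right and columns increase top to bottom; $\mathrm{supp}(T)$ is its set of entries. For $1\le i\le m$ and $2\le j\le\lambda_i$, $c_{ij}(T)=\#\{i'\ge i:\text{cell }(i',j-1)\text{ exists and }T_{i',j-1}<T_{ij}\}$ and $c(T)=\prod_{i=1}^m\prod_{j=2}^{\lambda_i}c_{ij}(T)$. For a set partition $\mathcal{A}$ of a finite set $S\subset\mathbb{N}$ with blocks $A_1,\dots,A_m$ listed in increasing order of least elements, $\mathcal{T}(\mathcal{A})$ is obtained by placing the $j$-th smallest element of $A_i$ in row $i$, column $j$, and then sorting each column into increasing order and top-justifying it. *)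

(* Defs.v *)
From mathcomp Require Import all_boot finmap.

Set Implicit Arguments.
Unset Strict Implicit.
Unset Printing Implicit Defensive.

Local Open Scope fset_scope.

(* An array is the sequence of its rows, top to bottom; rows and columns are
   indexed from 0, and the cell (i, j) exists iff j < size (nth [::] T i). *)
Definition has_cell (T : seq (seq nat)) (i j : nat) : bool :=
  j < size (nth [::] T i).

Definition entry (T : seq (seq nat)) (i j : nat) : nat :=
  nth 0 (nth [::] T i) j.

Definition is_partition_shape (s : seq nat) : bool :=
  sorted geq s && all (ltn 0) s.

Record multilinear_tableau (T : seq (seq nat)) : Prop := MultilinearTableau {
  mt_shape : is_partition_shape (shape T);
  mt_pos : forall i j, has_cell T i j -> 0 < entry T i j;
  mt_inj : forall i j i' j', has_cell T i j -> has_cell T i' j' ->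
    entry T i j = entry T i' j' -> i = i' /\ j = j';
  mt_rows : forall i j j', j < j' -> has_cell T i j' ->
    entry T i j < entry T i j';
  mt_cols : forall i i' j, i < i' -> has_cell T i' j ->
    entry T i j < entry T i' j
}.

Definition supp (T : seq (seq nat)) : {fset nat} := [fset x in flatten T].

(* The second column has index j = 1; only values j >= 1 are used. *)
Definition c_cell (T : seq (seq nat)) (i j : nat) : nat :=
  #|[set i' : 'I_(size T) | [&& i <= i', has_cell T i' j.-1 &
                              entry T i' j.-1 < entry T i j]]|.

Definition c_tab (T : seq (seq nat)) : nat :=
  \prod_(0 <= i < size T) \prod_(1 <= j < size (nth [::] T i)) c_cell T i j.

Definition is_set_partition (S : {fset nat}) (A : {fset {fset nat}}) : bool :=
  [&& fset0 \notin A, trivIfset A & fcover A == S].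

(* As each block is written in increasing order, its least element is its
   head. *)
Definition block_rows (A : {fset {fset nat}}) : seq (seq nat) :=
  sort (fun r r' => head 0 r <= head 0 r')
       [seq sort leq (enum_fset B) | B <- enum_fset A].

Definition sorted_column (rows : seq (seq nat)) (j : nat) : seq nat :=
  sort leq [seq nth 0 r j | r <- rows & j < size r].

Definition sort_columns (rows : seq (seq nat)) : seq (seq nat) :=
  let cols := mkseq (sorted_column rows) (\max_(r <- rows) size r) in
  mkseq (fun i => [seq nth 0 c i | c <- cols & i < size c]) (size rows).

Definition tableau_of (A : {fset {fset nat}}) : seq (seq nat) :=
  sort_columns (block_rows A).

Definition set_partitions (S : {fset nat}) : {fset {fset {fset nat}}} :=
  [fset A in fpowerset (fpowerset S) | is_set_partition S A].

(* The powerset bound in [set_partitions] is redundant. *)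
Lemma set_partitionsE (S : {fset nat}) (A : {fset {fset nat}}) :
  (A \in set_partitions S) = is_set_partition S A.
Proof.
rewrite !inE /= fpowersetE; apply: andb_idl => /and3P[_ _ /eqP <-].
apply/fsubsetP => B BA; rewrite fpowersetE.
exact: (bigfcup_sup (P := xpredT) id BA isT).
Qed.

(* Main.v *)
Require Import Defs.
From mathcomp Require Import all_boot finmap zify.

Set Implicit Arguments.
Unset Strict Implicit.
Unset Printing Implicit Defensive.

Local Open Scope fset_scope.

(** A partition [A] satisfies [T(A) = T] iff every entry [x] of [T], lying in
    column [rho x], has exactly [rho x] smaller elements in its block of [A].
    Partitions with a prescribed such rank function [rho] are counted by adding
    the elements in increasing order: [x] has to join a block with exactly
    [rho x] elements, or open a new one if [rho x = 0]. The number of blocks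
    with exactly [k + 1] elements is the number of earlier elements of rank [k]
    minus the number of those of rank [k + 1], so it depends on [rho] only, and
    the count is a product. For [x = T_ij] the factor is [c_ij(T)]. *)

(** * Sequences graded by a rank function *)

Definition graded (rho : nat -> nat) (r : seq nat) : bool :=
  [seq rho y | y <- r] == iota 0 (size r).

Definition sorted_block (B : {fset nat}) : seq nat := sort leq (enum_fset B).

Definition graded_partitions (rho : nat -> nat) (S : {fset nat}) :
    {fset {fset {fset nat}}} :=
  [fset A in set_partitions S |
    all (fun B : {fset nat} => graded rho (sorted_block B)) A].

Lemma mem_graded_partitions rho S A : (A \in graded_partitions rho S) =
  is_set_partition S A &&
  all (fun B : {fset nat} => graded rho (sorted_block B)) A.
Proof. by rewrite inE /= inE /= set_partitionsE. Qed.

Lemma mem_sorted_block B : sorted_block B =i B.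
Proof. by move=> y; rewrite mem_sort. Qed.

Lemma size_sorted_block B : size (sorted_block B) = #|` B|.
Proof. by rewrite size_sort. Qed.

Lemma graded_rcons rho r x :
  graded rho (rcons r x) = graded rho r && (rho x == size r).
Proof.
by rewrite /graded map_rcons size_rcons -addn1 iotaD add0n cats1 eqseq_rcons.
Qed.

Lemma gradedP rho r :
  reflect (forall j, j < size r -> rho (nth 0 r j) = j) (graded rho r).
Proof.
apply: (iffP eqP) => [e j jr | h].
  by rewrite -(nth_map _ 0) // e nth_iota.
apply: (@eq_from_nth _ 0) => [|j]; rewrite size_map ?size_iota // => jr.
by rewrite (nth_map 0) // nth_iota // h.
Qed.

(** Along [r] the ranks are 0, 1, 2 and so on, so rank [j] occurs at most once, at position [j]. *)
Lemma filter_graded rho r j : graded rho r ->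
  [seq y <- r | rho y == j] = if j < size r then [:: nth 0 r j] else [::].
Proof.
elim/last_ind: r => [|r x IHr]; first by [].
rewrite graded_rcons => /andP[/IHr {}IHr /eqP rx].
rewrite filter_rcons IHr rx size_rcons nth_rcons.
rewrite [size r == j]eq_sym ltnS.
by case: (ltngtP j (size r)).
Qed.

(** Up to order, column [j] thus depends only on the entries and on [rho], not on how the entries
    are split into rows. *)
Lemma column_graded rho rows j : all (graded rho) rows ->
  [seq nth 0 r j | r <- rows & j < size r] =
  [seq y <- flatten rows | rho y == j].
Proof.
elim: rows => [|r rows IHr] //= /andP[gr /IHr {}IHr].
by rewrite filter_cat -IHr filter_graded //; case: ifP.
Qed.

Lemma count_flatten_graded rho rows j : all (graded rho) rows ->
  count (fun y => rho y == j) (flatten rows) = count (fun r => j < size r) rows.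
Proof.
by move=> gr; rewrite -!size_filter -column_graded // size_map.
Qed.

(** Applied with block sizes for [f]; the subtraction is exact because the second count never
    exceeds the first. *)
Lemma count_eq_subn (U : Type) (f : U -> nat) k (s : seq U) :
  count (fun z => f z == k.+1) s =
  count (fun z => k < f z) s - count (fun z => k.+1 < f z) s.
Proof.
elim: s => //= z s ->.
have : count (fun z => k.+1 < f z) s <= count (fun z => k < f z) s.
  by apply: sub_count => y /= /ltnW.
by lia.
Qed.

(** * Set partitions, elementwise and as sequences *)

Lemma set_partitionP (S : {fset nat}) (A : {fset {fset nat}}) :
  reflect [/\ fset0 \notin A,
    forall B C y, B \in A -> C \in A -> y \in B -> y \in C -> B = C &
    forall y, y \in S <-> exists2 B, B \in A & y \in B]
  (is_set_partition S A).
Proof.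
apply: (iffP and3P) => [[A0 /trivIfsetP tA /eqP <-]|[A0 tA cA]]; split=> //.
- move=> B C y BA CA yB yC; apply/eqP/negPn/negP => /(tA _ _ BA CA).
  by move/fdisjointP/(_ _ yB)/negP; apply.
- move=> y; split=> [/bigfcupP[B]|[B BA yB]].
    by rewrite andbT; exists B.
  by apply/bigfcupP; exists B; rewrite ?BA.
- apply/trivIfsetP => B C BA CA BC; apply/fdisjointP => y yB.
  by apply/negP => yC; rewrite (tA B C y) ?eqxx in BC.
- apply/eqP/fsetP => y; apply/bigfcupP/idP => [[B]|/cA[B BA yB]].
    by rewrite andbT => BA yB; apply/cA; exists B.
  by exists B; rewrite ?BA.
Qed.

Lemma perm_flatten_blocks S A : is_set_partition S A ->
  perm_eq (flatten [seq sorted_block B | B <- enum_fset A]) S.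
Proof.
move=> /[dup] /set_partitionP[_ _ cA] /and3P[_ tA /eqP defS].
have memS : flatten [seq sorted_block B | B <- enum_fset A] =i S.
  move=> y; apply/flatten_mapP/idP => [[B BA yB]|/cA[B BA yB]].
    by apply/cA; exists B; rewrite // -mem_sorted_block.
  by exists B; rewrite ?mem_sorted_block.
apply: (uniq_perm _ (fset_uniq _) memS).
(* A listing of [S] that is no longer than [S] has no repetition, and [trivIfset] says that the
   block sizes add up to the size of the union. *)
apply: (leq_size_uniq (fset_uniq S)) => [y|]; first by rewrite memS.
rewrite size_flatten sumnE /shape !big_map -defS -(eqP tA).
by under eq_bigr do rewrite size_sorted_block.
Qed.

Lemma sorted_blockU1 (x : nat) (B : {fset nat}) : (forall y, y \in B -> y < x) ->
  sorted_block (x |` B) = rcons (sorted_block B) x.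
Proof.
move=> ltx; have xB : x \notin B by apply/negP => /ltx; rewrite ltnn.
apply: (sorted_eq leq_trans anti_leq); first exact: sort_sorted leq_total _.
  have : all (leq^~ x) (sorted_block B).
    by apply/allP => y; rewrite mem_sorted_block => /ltx /ltnW.
  have : sorted leq (sorted_block B) by exact: sort_sorted leq_total _.
  case: (sorted_block B) => //= a s pas /andP[ax sx]; rewrite rcons_path pas /=.
  by have := mem_last a s; rewrite inE => /predU1P[->|/(allP sx)].
apply: uniq_perm => [||y]; first by rewrite sort_uniq fset_uniq.
  by rewrite rcons_uniq mem_sorted_block xB sort_uniq fset_uniq.
by rewrite mem_rcons inE !mem_sorted_block !inE.
Qed.

(** * Adding a new maximum, and the resulting product formula *)

Section AddMaximum.
Variables (rho : nat -> nat) (S : {fset nat}) (x : nat).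
Hypothesis ltx : forall y, y \in S -> y < x.

(* [fset0] stands for the choice of opening a new block. *)
Definition slots (A : {fset {fset nat}}) : seq {fset nat} :=
  [seq B <- fset0 :: enum_fset A | #|` B| == rho x].

(** For [B = fset0] nothing is removed from a partition and the block added is the singleton of [x],
    so one formula covers both choices. *)
Definition insert_in (A : {fset {fset nat}}) (B : {fset nat}) :=
  (x |` B) |` (A `\ B).

Let xS : x \notin S.
Proof. by apply/negP => /ltx; rewrite ltnn. Qed.

Let block_sub A B y :
  is_set_partition S A -> B \in fset0 :: enum_fset A -> y \in B -> y \in S.
Proof.
move=> /set_partitionP[_ _ cA]; rewrite inE => /predU1P[->|BA yB].
  by rewrite inE.
by apply/cA; exists B.
Qed.

(** The new maximum comes last in its sorted block, so its position is the size of [B]. *)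
Let graded_block A B : is_set_partition S A -> B \in fset0 :: enum_fset A ->
  graded rho (sorted_block (x |` B)) =
  graded rho (sorted_block B) && (rho x == #|` B|).
Proof.
move=> pA BA; rewrite sorted_blockU1 ?graded_rcons ?size_sorted_block //.
by move=> y /(block_sub pA BA) /ltx.
Qed.

Lemma insert_in_graded A B : A \in graded_partitions rho S -> B \in slots A ->
  insert_in A B \in graded_partitions rho (x |` S).
Proof.
rewrite !mem_graded_partitions mem_filter => /andP[pA /allP gA] /andP[/eqP cB BA].
have [A0 tA cA] := set_partitionP _ _ pA.
have sub D y : D \in A -> y \in D -> y \in S by move=> DA yD; apply/cA; exists D.
apply/andP; split.
  apply/set_partitionP; split.
  - rewrite !inE negb_or (negPf A0) andbF andbT; apply/eqP => /fsetP/(_ x).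
    by rewrite !inE eqxx.
  (* The enlarged block meets no other block: [x] is outside [S], and [B] is empty or itself a block
     of [A]. *)
  - have cross D y : D \in A -> D != B -> y \in x |` B -> y \in D -> False.
      move=> DA nDB; rewrite !inE => /predU1P[->|yB] yD.
        by move: xS; rewrite (sub D).
      move: BA; rewrite inE => /predU1P[B0|BA]; first by rewrite B0 inE in yB.
      by rewrite (tA D B y) ?eqxx in nDB.
    move=> D E y; rewrite !inE => /predU1P[->|/andP[nD DA]].
      move=> /predU1P[->|/andP[nE EA]] // yB yE.
      by case: (cross E y EA nE).
    move=> /predU1P[->|/andP[nE EA]]; last exact: tA.
    by move=> yD yB; case: (cross D y DA nD).
  - move=> y; split.
      rewrite inE in_fset1 => /predU1P[->|yS].
        by exists (x |` B); rewrite !inE eqxx.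
      have /cA[D DA yD] := yS.
      have [DB|DB] := eqVneq D B.
        by exists (x |` B); rewrite !inE ?eqxx // -DB yD orbT.
      by exists D; rewrite // !inE DB DA orbT.
    move=> [D]; rewrite !inE => /predU1P[->|/andP[_ DA]] yD.
      by move: yD; rewrite !inE; case/predU1P => [->|/(block_sub pA BA)->];
        rewrite ?eqxx ?orbT.
    by rewrite (sub D) ?orbT.
apply/allP => D; rewrite !inE => /predU1P[->|/andP[_ /gA //]].
rewrite (graded_block pA BA) cB eqxx andbT.
by move: BA; rewrite inE => /predU1P[->|/gA //]; rewrite /sorted_block.
Qed.

Lemma insert_in_surj A : A \in graded_partitions rho (x |` S) ->
  exists A' B, [/\ A' \in graded_partitions rho S, B \in slots A' &
    A = insert_in A' B].
Proof.
rewrite !mem_graded_partitions => /andP[pA /allP gA].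
have [A0 tA cA] := set_partitionP _ _ pA.
have /cA[D DA xD] : x \in x |` S by rewrite !inE eqxx.
(* Delete [x] from its block [D]. If [D] is the singleton of [x], then [B] is [fset0], which must
   not stay as a block. *)
pose B := D `\ x; pose A' := (B |` (A `\ D)) `\ fset0.
have DE : D = x |` B by rewrite fsetD1K.
have memA' E : E \in A' = (E != fset0) && ((E == B) || (E != D) && (E \in A)).
  by rewrite !inE.
have BA' : B \in fset0 :: enum_fset A'.
  by rewrite inE; case: eqVneq => //= nB; rewrite memA' nB eqxx.
(* Needed at the end, where [insert_in] removes [B] and must not take a block of [A] with it. *)
have nBA : B != fset0 -> B \notin A.
  case/fset0Pn => y yB; apply/negP => BA.
  have yD : y \in D by rewrite DE inE yB orbT.
  by have := xD; rewrite -(tA B D y) // !inE eqxx.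
have pA' : is_set_partition S A'.
  apply/set_partitionP; split; first by rewrite memA' eqxx.
  - have cross E y : E != D -> E \in A -> y \in B -> y \in E -> False.
      move=> nE EA; rewrite !inE => /andP[_ yD] yE.
      by rewrite (tA E D y) ?eqxx in nE.
    move=> E F y; rewrite !memA' => /andP[_ /predU1P[->|/andP[nE EA]]].
      move=> /andP[_ /predU1P[->|/andP[nF FA]]] // yB yF.
      by case: (cross F y).
    move=> /andP[_ /predU1P[->|/andP[nF FA]]]; last exact: tA.
    by move=> yE yB; case: (cross E y).
  - move=> y; split=> [yS|[E]].
      have yx : y != x by apply: contraTneq yS => ->.
      have /cA[E EA yE] : y \in x |` S by rewrite !inE yS orbT.
      have [ED|nED] := eqVneq E D.
        have yB : y \in B by rewrite !inE yx -ED.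
        exists B => //; rewrite memA' eqxx andbT.
        by apply/fset0Pn; exists y.
      exists E => //; rewrite memA' nED EA orbT andbT.
      by apply/fset0Pn; exists y.
    rewrite memA' => /andP[_ /predU1P[->|/andP[nE EA]]] yE.
      move: yE; rewrite !inE => /andP[yx yD].
      have : y \in x |` S by apply/cA; exists D.
      by rewrite !inE (negPf yx).
    have : y \in x |` S by apply/cA; exists E.
    rewrite !inE => /predU1P[yx|//]; rewrite (tA E D y) ?eqxx // in nE.
    by rewrite yx.
have := gA D DA; rewrite DE (graded_block pA' BA') => /andP[gB /eqP cB].
exists A', B; split.
- rewrite mem_graded_partitions pA' /=; apply/allP => E.
  by rewrite memA' => /andP[_ /predU1P[->//|/andP[_ /gA]]].
- by rewrite mem_filter cB eqxx.
- apply/fsetP => E; rewrite inE in_fset1 in_fsetD1 memA' -DE.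
  have [->|nED] := eqVneq E D; first by rewrite DA.
  have [->|nEB] /= := eqVneq E B; last first.
    by case: eqVneq => [->|] //; rewrite (negPf A0).
  by case: (eqVneq B fset0) => [->|/nBA /negPf //]; exact: negPf.
Qed.

(** The only block containing [x] gives back [B]; putting [B] in its place, or nothing if [B] is
    empty, gives back [A]. *)
Lemma insert_in_inj A A' B B' :
  is_set_partition S A -> is_set_partition S A' ->
  B \in slots A -> B' \in slots A' ->
  insert_in A B = insert_in A' B' -> A = A' /\ B = B'.
Proof.
rewrite !mem_filter => pA pA' /andP[_ BA] /andP[_ BA'] eA.
have [A0 tA cA] := set_partitionP _ _ pA.
have [A0' tA' cA'] := set_partitionP _ _ pA'.
have xB : x \notin B by apply: contra xS; exact: block_sub pA BA.
have xB' : x \notin B' by apply: contra xS; exact: block_sub pA' BA'.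
have eB : B = B'.
  have : x |` B \in insert_in A' B' by rewrite -eA !inE eqxx.
  rewrite !inE => /predU1P[e|/andP[_ xA']].
    by rewrite -(fsetU1K xB) e fsetU1K.
  by case/negP: xS; apply/cA'; exists (x |` B); rewrite ?inE ?eqxx.
split=> //; subst B'.
have strip C : is_set_partition S C -> B \in fset0 :: enum_fset C ->
    C = (B |` (insert_in C B `\ (x |` B))) `\ fset0.
  move=> pC BC; have [C0 _ cC] := set_partitionP _ _ pC.
  have xC : x |` B \notin C.
    apply: contra xS => xC; apply/cC; exists (x |` B) => //.
    by rewrite !inE eqxx.
  apply/fsetP => E; rewrite !inE.
  have [->|nE0] /= := eqVneq E fset0; first exact: negPf.
  have [EB|nEB] /= := eqVneq E B.
    by move: BC; rewrite inE -EB (negPf nE0).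
  by have [->|] /= := eqVneq E (x |` B); first exact: negPf.
by rewrite (strip A) // (strip A') // eA.
Qed.

(** Rank 0 leaves only the new block, since blocks are nonempty. For rank [k.+1], blocks of that
    size are counted through ranks. The result does not depend on [A]. *)
Lemma size_slots A : A \in graded_partitions rho S ->
  size (slots A) =
    if rho x is k.+1 then count (fun y => rho y == k) S
                          - count (fun y => rho y == k.+1) S
    else 1.
Proof.
rewrite mem_graded_partitions => /andP[pA gA].
have /and3P[A0 _ _] := pA.
rewrite size_filter -[count _ _]/((#|` fset0| == _) + count _ (enum_fset A))%N.
rewrite cardfs0; case: (rho x) => [|k] /=.
  apply/eqP; rewrite eqSS -leqn0 leqNgt -has_count; apply/hasPn => B BA.
  by rewrite cardfs_eq0; apply: contraNneq A0 => <-.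
(* A block with more than [j] elements has exactly one element of rank [j]; smaller blocks have
   none. *)
have cntS j :
    count (fun y => rho y == j) S =
    count (fun B : {fset nat} => j < #|` B|) (enum_fset A).
  rewrite -(permP (perm_flatten_blocks pA)) count_flatten_graded ?all_map //.
  by rewrite count_map; apply: eq_count => B /=; rewrite size_sorted_block.
by rewrite !cntS add0n (count_eq_subn (fun B : {fset nat} => #|` B|)).
Qed.

(** [insert_in] is a bijection from the pairs of a graded partition and one of its slots, and all
    partitions have equally many slots. *)
Lemma card_graded_partitionsU1 :
  #|` graded_partitions rho (x |` S)| =
  #|` graded_partitions rho S| *
    if rho x is k.+1 then count (fun y => rho y == k) S
                          - count (fun y => rho y == k.+1) S
    else 1.
Proof.
pose P := graded_partitions rho S.
have partP A : A \in P -> is_set_partition S A.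
  by rewrite mem_graded_partitions => /andP[].
have -> : #|` graded_partitions rho (x |` S)| =
    size [seq insert_in A B | A <- enum_fset P, B <- slots A].
  apply/perm_size/uniq_perm; first exact: fset_uniq.
    apply: allpairs_uniq_dep => [|A AP|]; first exact: fset_uniq.
      rewrite filter_uniq //= fset_uniq andbT.
      by case/partP/and3P: AP.
    move=> _ _ /allpairsPdep[A [B [AP BA ->]]] /allpairsPdep[A' [B' [AP' BA' ->]]].
    move=> /= /insert_in_inj h.
    by have [-> ->] := h (partP _ AP) (partP _ AP') BA BA'.
  move=> A; apply/idP/allpairsPdep => [/insert_in_surj //|[A' [B [A'P BA' ->]]]].
  exact: insert_in_graded.
rewrite size_allpairs_dep sumnE big_map (eq_big_seq _ size_slots) /=.
by rewrite big_const_seq count_predT iter_addn_0 mulnC.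
Qed.

End AddMaximum.

(* If the truncated subtraction underflows at [x], then the elements below [x]
   have no graded partition, so an earlier factor already vanishes. *)
Definition predecessor_choices (rho : nat -> nat) (s : seq nat) (x : nat) : nat :=
  if rho x is k.+1 then count (fun y => (y < x) && (rho y == k)) s
                        - count (fun y => (y < x) && (rho y == k.+1)) s
  else 1.

Lemma card_graded_partitions rho s : sorted ltn s ->
  #|` graded_partitions rho [fset y in s]| =
  \prod_(x <- s) predecessor_choices rho s x.
Proof.
elim/last_ind: s => [_|s x IHs ss].
  (* The empty set has one partition, the one without blocks. *)
  rewrite big_nil; apply/eqP/cardfs1P; exists fset0.
  apply/fsetP => A; rewrite mem_graded_partitions in_fset1.
  apply/andP/eqP => [[/set_partitionP[A0 _ cA] _]|->].
    apply/eqP; rewrite -[_ == _]negbK; apply/negP => /fset0Pn[B BA].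
    have [B0|/fset0Pn[y yB]] := eqVneq B fset0; first by rewrite -B0 BA in A0.
    by have : y \in [fset y in Nil nat] by [apply/cA; exists B]; rewrite inE.
  split=> //; apply/set_partitionP; split=> // y.
  by rewrite inE; split=> // -[].
have ltx y : y \in s -> y < x.
  move: ss; rewrite -cats1 => ss.
  have : allrel ltn s [:: x].
    by move: ss; rewrite (sorted_pairwise ltn_trans) pairwise_cat => /and3P[].
  by move/allrelP => h ys; apply: h; rewrite // inE.
have srt : sorted ltn s by move: ss; rewrite -cats1 => /cat_sorted2[].
have us : uniq s by exact: sorted_uniq ltn_trans ltnn _ srt.
have -> : [fset y in rcons s x] = x |` [fset y in s].
  by apply/fsetP => y; rewrite !inE /= mem_rcons inE.
rewrite card_graded_partitionsU1 => [|y]; last by rewrite inE /= => /ltx.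
rewrite IHs // big_rcons /=.
have cnt a : count (fun y => (y < x) && a y) (rcons s x) = count a [fset y in s].
  rewrite -cats1 count_cat /= ltnn /= !addn0.
  have /permP -> : perm_eq [fset y in s] s.
    by apply: uniq_perm => [||y]; rewrite ?fset_uniq // !inE.
  by apply: eq_in_count => y /ltx ->.
rewrite /predecessor_choices; congr (_ * _);
  last by case: (rho x) => // k; rewrite !cnt.
(* The appended maximum is not below [y], so earlier factors do not change. *)
apply: eq_big_seq => y /ltx yx; case: (rho y) => // k.
by rewrite -cats1 !count_cat /= ltnNge (ltnW yx) /= !addn0.
Qed.

(** * Cells of column-sorted arrays *)

(** Justification of rows and columns: filtering by a downward closed condition keeps an initial
    segment, so positions do not shift. *)
Lemma filter_iota_downward (p : pred nat) n :
  (forall j j', j <= j' -> p j' -> p j) ->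
  exists m, [/\ m <= n, forall j, j < n -> p j = (j < m) &
    [seq j <- iota 0 n | p j] = iota 0 m].
Proof.
move=> dp; elim: n => [|n [m [mn pm fm]]]; first by exists 0.
rewrite -addn1 iotaD filter_cat fm add0n /= addn1.
have [pn|npn] := boolP (p n); last first.
  exists m; rewrite cats0; split=> // [|j]; first exact: leqW.
  rewrite ltnS leq_eqVlt => /predU1P[->|/pm //].
  by rewrite (negPf npn) ltnNge mn.
have mE : m = n.
  apply/eqP; rewrite eqn_leq mn leqNgt; apply/negP => mltn.
  by have := dp m n mn pn; rewrite pm ?ltnn.
exists n.+1; split=> // [j jn|]; first by rewrite jn (dp j n).
by rewrite mE -[X in _ = iota 0 X]addn1 iotaD.
Qed.

(** Cells do not detect empty rows, hence the separate condition on the number of rows. *)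
Lemma array_ext (T T' : seq (seq nat)) : size T = size T' ->
  (forall i j, has_cell T i j = has_cell T' i j) ->
  (forall i j, has_cell T i j -> entry T i j = entry T' i j) -> T = T'.
Proof.
move=> eqs eqc eqe; apply: (@eq_from_nth _ [::]) => // i _.
have sz : size (nth [::] T i) = size (nth [::] T' i).
  apply/eqP; rewrite eqn_leq; apply/andP; split; rewrite leqNgt; apply/negP => h.
    (* The cell just past the end of the shorter row lies in only one of the arrays. *)
    by have := eqc i (size (nth [::] T' i)); rewrite /has_cell ltnn h.
  by have := eqc i (size (nth [::] T i)); rewrite /has_cell ltnn h.
by apply: (@eq_from_nth _ 0) => // j /eqe.
Qed.

Lemma size_sorted_column rows j :
  size (sorted_column rows j) = count (fun r => j < size r) rows.
Proof. by rewrite size_sort size_map size_filter. Qed.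

Lemma size_sorted_column0 rows : all (fun r => 0 < size r) rows ->
  size (sorted_column rows 0) = size rows.
Proof. by move=> pr; apply/eqP; rewrite size_sorted_column -all_count. Qed.

(** A row reaching some column reaches all earlier ones, so column lengths weakly decrease and the
    columns reaching row [i] form an initial segment. *)
Lemma sort_columns_cell rows i j :
  has_cell (sort_columns rows) i j = (i < size (sorted_column rows j)) /\
  (has_cell (sort_columns rows) i j ->
   entry (sort_columns rows) i j = nth 0 (sorted_column rows j) i).
Proof.
rewrite /has_cell /entry /sort_columns.
set n := \max_(r <- rows) size r.
have [m [mn pm fm]] :
    exists m, [/\ m <= n,
    forall j, j < n -> (i < size (sorted_column rows j)) = (j < m) &
    [seq j <- iota 0 n | i < size (sorted_column rows j)] = iota 0 m].
  apply: filter_iota_downward => k k' kk' /leq_trans; apply.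
  by rewrite !size_sorted_column; apply: sub_count => r /=; apply: leq_ltn_trans.
have [ir|ri] := ltnP i (size rows); last first.
  rewrite nth_default ?size_mkseq //=; split=> //.
  apply/esym/negbTE; rewrite -leqNgt size_sorted_column.
  exact: leq_trans (count_size _ _) ri.
rewrite nth_mkseq // filter_map -map_comp.
rewrite (eq_filter (a2 := fun j => i < size (sorted_column rows j))) //.
rewrite fm size_map size_iota; split=> [|jm]; last first.
  by rewrite (nth_map 0) ?size_iota //= nth_iota.
(* From the maximal row length [n] on, columns are empty. *)
have [/pm <- //|nj] := ltnP j n.
rewrite ltnNge (leq_trans mn nj) ltnNge size_sorted_column.
suff -> : count (fun r => j < size r) rows = 0 by [].
apply/eqP; rewrite -leqn0 leqNgt -has_count; apply/hasPn => r rr.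
by rewrite -leqNgt (leq_trans _ nj) // /n (big_rem r) //= leq_maxl.
Qed.

Lemma flatten_entries T :
  flatten T = [seq entry T i j | i <- iota 0 (size T),
                                 j <- iota 0 (size (nth [::] T i))].
Proof.
rewrite -{1}(mkseq_nth [::] T) /mkseq; congr flatten; apply: eq_map => i.
by rewrite -{1}(mkseq_nth 0 (nth [::] T i)).
Qed.

(** * Tableaux and their column function *)

(** The rank function to which the count is applied. Off the entries the row found is the default
    [[::]] and the value is 0. *)
Definition column_of (T : seq (seq nat)) (x : nat) : nat :=
  index x (nth [::] T (find (fun r => x \in r) T)).

Section Tableau.
Variable T : seq (seq nat).
Hypothesis hT : multilinear_tableau T.

Let cell_row i j : has_cell T i j -> i < size T.
Proof.
by rewrite ltnNge; apply: contraL => h; rewrite /has_cell nth_default.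
Qed.

Lemma column_of_entry i j : has_cell T i j -> column_of T (entry T i j) = j.
Proof.
move=> cij; set x := entry T i j.
have hx : has (fun r => x \in r) T.
  by apply/hasP; exists (nth [::] T i); rewrite mem_nth // (cell_row cij).
have xr := nth_find [::] hx.
have cx : has_cell T (find (fun r => x \in r) T) (column_of T x).
  by rewrite /has_cell index_mem.
by have [] := mt_inj hT cx cij; rewrite // /entry nth_index.
Qed.

Lemma graded_rows : all (graded (column_of T)) T.
Proof.
apply/(all_nthP [::]) => i _; apply/gradedP => j ji.
exact: (@column_of_entry i j).
Qed.

Lemma row_nonempty : all (fun r => 0 < size r) T.
Proof. by have /andP[_] := mt_shape hT; rewrite all_map. Qed.

Lemma uniq_flatten_tableau : uniq (flatten T).
Proof.
rewrite flatten_entries; apply: allpairs_uniq_dep => [|i _|]; rewrite ?iota_uniq //.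
move=> _ _ /allpairsPdep[i [j [_ ji ->]]] /allpairsPdep[i' [j' [_ ji' ->]]] /= e.
move: ji ji'; rewrite !mem_iota !add0n /= => ji ji'.
by have [-> ->] := mt_inj hT ji ji' e.
Qed.

Lemma perm_supp : perm_eq (supp T) (flatten T).
Proof.
by apply: uniq_perm => [||y]; rewrite ?fset_uniq ?uniq_flatten_tableau // !inE.
Qed.

Lemma has_cell_up i i' j : i <= i' -> has_cell T i' j -> has_cell T i j.
Proof.
move=> ii' c; have iT' := cell_row c; apply: leq_trans c _.
have /andP[ss _] := mt_shape hT.
have geq_tr : transitive geq by move=> a b d /= ba ad; exact: leq_trans ad ba.
have := sorted_leq_nth geq_tr leqnn 0 ss.
rewrite /shape size_map => /(_ i i').
rewrite !inE => /(_ (leq_ltn_trans ii' iT') iT' ii').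
by rewrite !(nth_map [::]) // (leq_ltn_trans ii' iT').
Qed.

(** The columns of [T] are already increasing and top-justified. The form matches
    [sort_columns_cell], so that equal sorted columns give equal arrays. *)
Lemma tableau_cell i j :
  has_cell T i j = (i < size (sorted_column T j)) /\
  (has_cell T i j -> entry T i j = nth 0 (sorted_column T j) i).
Proof.
have [m [mn pm fm]] : exists m, [/\ m <= size T,
    forall i, i < size T -> has_cell T i j = (i < m) &
    [seq i <- iota 0 (size T) | has_cell T i j] = iota 0 m].
  by apply: filter_iota_downward => k k' kk'; apply: has_cell_up.
have colE : sorted_column T j = [seq entry T i j | i <- iota 0 m].
  rewrite /sorted_column -{1}(mkseq_nth [::] T) filter_map -map_comp.
  rewrite (eq_filter (a2 := has_cell T ^~ j)) // fm (sorted_sort leq_trans) //.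
  apply/(sortedP 0) => k; rewrite size_map size_iota => km.
  rewrite !(nth_map 0) ?size_iota ?(ltnW km) // !nth_iota ?(ltnW km) // !add0n.
  apply/ltnW/(mt_cols hT); first exact: ltnSn.
  by rewrite pm // (leq_trans km).
rewrite colE size_map size_iota; split=> [|cij].
  have [/pm //|Ti] := ltnP i (size T).
  rewrite ltnNge (leq_trans mn Ti); apply/negbTE/negP => /cell_row.
  by rewrite ltnNge Ti.
have im : i < m by rewrite -pm // (cell_row cij).
by rewrite (nth_map 0) ?size_iota // nth_iota.
Qed.

Lemma tableau_of_eq A : is_set_partition (supp T) A ->
  (tableau_of A == T) =
  all (fun B : {fset nat} => graded (column_of T) (sorted_block B)) A.
Proof.
move=> pA; rewrite /tableau_of; set rows := block_rows A.
have prows : perm_eq rows [seq sorted_block B | B <- enum_fset A].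
  by rewrite /rows /block_rows perm_sort.
apply/eqP/idP => [eT|gA].
  apply/allP => B BA; apply/gradedP => j jB.
  (* Element [j] of a block is placed in column [j], hence is an entry of column [j] of [T]. *)
  have xc : nth 0 (sorted_block B) j \in sorted_column rows j.
    rewrite mem_sort; apply/mapP; exists (sorted_block B) => //.
    by rewrite mem_filter jB (perm_mem prows) map_f.
  have [hc he] := sort_columns_cell rows
    (index (nth 0 (sorted_block B) j) (sorted_column rows j)) j.
  rewrite index_mem xc in hc; rewrite hc eT in he.
  rewrite -{1}(nth_index 0 xc) -he //; apply: column_of_entry.
  by rewrite -eT hc.
have gr : all (graded (column_of T)) rows.
  by rewrite (perm_all _ prows) all_map.
(* Both columns consist of the elements of rank [j] in the common support. *)
have colE j : sorted_column rows j = sorted_column T j.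
  apply/(perm_sortP leq_total leq_trans anti_leq).
  rewrite !(@column_graded (column_of T)) ?graded_rows //; apply: perm_filter.
  rewrite (perm_trans (perm_flatten prows)) //.
  exact: perm_trans (perm_flatten_blocks pA) perm_supp.
apply: array_ext => [|i j|i j].
(* Column 0 meets every row, as no row or block is empty, so its length is the number of rows. *)
- rewrite size_mkseq -!size_sorted_column0 ?colE ?row_nonempty //.
  rewrite (perm_all _ prows) all_map; apply/allP => B BA /=.
  rewrite size_sorted_block cardfs_gt0.
  by case/and3P: pA => A0 _ _; apply: contraNneq A0 => <-.
- by rewrite (sort_columns_cell rows i j).1 (tableau_cell i j).1 colE.
- move=> c; rewrite (sort_columns_cell rows i j).2 // (tableau_cell i j).2 ?colE //.
  by rewrite (tableau_cell i j).1 -colE -(sort_columns_cell rows i j).1.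
Qed.

(** * Comparing the factors with [c_cell] *)

(** Passes from entries to row indices, over which [c_cell] counts too. *)
Lemma count_column x k :
  count (fun y => (y < x) && (column_of T y == k)) (flatten T) =
  count (fun i => has_cell T i k && (entry T i k < x)) (iota 0 (size T)).
Proof.
rewrite -size_filter filter_predI -(column_graded _ graded_rows).
rewrite size_filter count_map count_filter.
rewrite -[X in count _ X](mkseq_nth [::] T) count_map.
by apply: eq_count => i; rewrite /= andbC.
Qed.

Lemma c_cell_count i j :
  c_cell T i j = count (fun i' => [&& i <= i', has_cell T i' j.-1 &
                                    entry T i' j.-1 < entry T i j])
                       (iota 0 (size T)).
Proof.
rewrite /c_cell cardsE -sum1_card -sum1_count.
by rewrite -[X in iota 0 X]subn0 -/(index_iota 0 (size T)) big_mkord.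
Qed.

(* The rows above row [i] account for exactly the [i] entries of column [j]
   smaller than [T_ij], and their entries in column [j - 1] all qualify. *)
Lemma predecessor_choices_entry i j : has_cell T i j ->
  predecessor_choices (column_of T) (flatten T) (entry T i j) =
  if j == 0 then 1 else c_cell T i j.
Proof.
move=> cij; rewrite /predecessor_choices column_of_entry //.
case: j cij => [//|k] cij; rewrite !count_column c_cell_count /=.
set p := fun i' : nat => _; set q := fun i' : nat => _; set r := fun i' : nat => _.
(* Above row [i], [p] and [q] hold and [r] fails; from row [i] on, [q] fails and [p] agrees with
   [r]. *)
have cells i' : p i' = (q i' + r i')%N :> nat.
  rewrite /p /q /r; have [i'i|ii'] := ltnP i' i.
    have c := has_cell_up (ltnW i'i) cij.
    have lt_col := mt_cols hT i'i cij.
    have lt_row := mt_rows hT (ltnSn k) c.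
    by rewrite c lt_col (ltn_trans lt_row lt_col) /has_cell (ltnW c).
  suff -> : has_cell T i' k.+1 && (entry T i' k.+1 < entry T i k.+1) = false by [].
  apply/negbTE/nandP.
  have [c|_] := boolP (has_cell T i' k.+1); [right|by left].
  move: ii'; rewrite leq_eqVlt => /predU1P[->|ii']; first by rewrite ltnn.
  by rewrite -leqNgt ltnW // (mt_cols hT).
suff -> : count p (iota 0 (size T)) =
    (count q (iota 0 (size T)) + count r (iota 0 (size T)))%N.
  by rewrite addKn.
by elim: (iota _ _) => //= i' s ->; rewrite cells addnACA.
Qed.

Lemma c_tabE :
  c_tab T = \prod_(x <- flatten T) predecessor_choices (column_of T) (flatten T) x.
Proof.
rewrite {1}flatten_entries big_allpairs_dep /c_tab /index_iota subn0.
apply: eq_bigr => i _; rewrite -[in RHS](subn0 (size _)) -/(index_iota 0 _).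
(* This exposes the range condition on [j], which is [has_cell T i j]. *)
rewrite [RHS]big_nat.
rewrite (eq_bigr _ (fun j h => predecessor_choices_entry (proj2 (andP h)))).
rewrite -big_nat; case: (size _) => [|n]; first by rewrite big_nil big_geq.
(* The factor of column 0 is 1, so the product may start at column 1. *)
rewrite -/(index_iota 1 n.+1) [RHS]big_ltn //= mul1n.
by apply: eq_big_nat => -[|j].
Qed.

End Tableau.

Theorem theorem2p10 (T : seq (seq nat)) (hT : multilinear_tableau T) :
  #|` [fset A in set_partitions (supp T) | tableau_of A == T]%fset | = c_tab T.
Proof.
(* The product formula needs an increasing listing; both the product and the counts in its factors
   are invariant under permutation. *)
pose s := sort leq (flatten T).
have ps : perm_eq s (flatten T) by rewrite perm_sort.
have -> : [fset A in set_partitions (supp T) | tableau_of A == T] =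
    graded_partitions (column_of T) [fset y in s].
  have -> : [fset y in s] = supp T.
    by apply/fsetP => y; rewrite !inE /= (perm_mem ps).
  apply/fsetP => A; rewrite mem_graded_partitions inE /= inE /= set_partitionsE.
  by apply: andb_id2l => /(tableau_of_eq hT).
rewrite card_graded_partitions; last first.
  by rewrite ltn_sorted_uniq_leq sort_uniq uniq_flatten_tableau //=
    (sort_sorted leq_total).
rewrite c_tabE // (perm_big _ ps); apply: eq_bigr => x _.
by rewrite /predecessor_choices; case: (column_of T x) => // k; rewrite !(permP ps).
Qed.
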